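(* Let $n\ge 2$ and let $w_0$ be the longest element of the Weyl group $W(D_n)$. Then $$\operatorname{diam}(G(w_0)) < |L_2|+\frac{4}{3}n^3.$$
   Context: Type $D_n$: the positive roots are $\Phi^+=\{e_j-e_i: 1\le i<j\le n\}\cup\{e_j+e_i:1\le i<j\le n\}\subset\mathbb{R}^n$. The simple roots are $\alpha_1=e_1+e_2$ and $\alpha_i=e_i-e_{i-1}$ for $2\le i\le n$. $s_i$ is the reflection in the hyperplane orthogonal to $\alpha_i$, and $W(D_n)$ is the group generated by $s_1,\dots,s_n$, with $m_{ij}$ the order of $s_is_j$. $w_0$ is the unique element of maximum Coxeter length. $G(w_0)$ is the graph whose vertices are the reduced words of $w_0$. Two reduced words are joined by an edge when they differ by a single application of a Coxeter relation $s_is_j\cdots=s_js_i\cdots$ ($m_{ij}$ letters on each side, $i\neq j$). $\operatorname{diam}$ denotes the maximum graph distance between two vertices. $L_2$ is the set of codimension-two subspaces of $\mathbb{R}^n$ that are intersections of hyperplanes from the arrangement $\{H_\alpha:\alpha\in\Phi^+\}$, where $H_\alpha=\{x\in\mathbb{R}^n:\langle x,\alpha\rangle=0\}$. *)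

(* Defs.v *)
From mathcomp Require Import all_boot all_order all_algebra finmap reals.

Set Implicit Arguments.
Unset Strict Implicit.
Unset Printing Implicit Defensive.

Import Order.TTheory GRing.Theory Num.Theory.

Local Open Scope fset_scope.
Local Open Scope ring_scope.

Section TypeD.
Variables (R : realType) (n : nat).

Definition dot (x y : 'rV[R]_n) : R := (x *m y^T) 0 0.

(* Coordinates are numbered from 0, so the e_{k+1} of the usual numbering is
   [evec k]; it is the zero vector when n <= k. *)
Definition evec (k : nat) : 'rV[R]_n := \row_(j < n) (j == k :> nat)%:R.

Definition pos_roots : {fset 'rV[R]_n} :=
  [fset evec p.2 - evec p.1
     | p : 'I_n * 'I_n in [pred p : 'I_n * 'I_n | (p.1 < p.2)%N]] `|`
  [fset evec p.2 + evec p.1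
     | p : 'I_n * 'I_n in [pred p : 'I_n * 'I_n | (p.1 < p.2)%N]].

Definition simple_root (i : 'I_n) : 'rV[R]_n :=
  if i == 0%N :> nat then evec 0 + evec 1 else evec i - evec i.-1.

(* The matrix is symmetric, so it represents the reflection both on row and on
   column vectors; see [mul_reflection]. *)
Definition reflection (a : 'rV[R]_n) : 'M[R]_n :=
  1%:M - (2 / dot a a) *: (a^T *m a).

Lemma mul_reflection (a x : 'rV[R]_n) :
  x *m reflection a = x - (2 * dot x a / dot a a) *: a.
Proof.
rewrite /reflection mulmxBr mulmx1 -scalemxAr mulmxA.
rewrite [x *m a^T]mx11_scalar mul_scalar_mx scalerA -/(dot x a).
by rewrite mulrAC.
Qed.

Definition simple_refl (i : 'I_n) : 'M[R]_n := reflection (simple_root i).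

Inductive weyl : 'M[R]_n -> Prop :=
| weyl_one : weyl 1%:M
| weyl_gen i : weyl (simple_refl i)
| weyl_mul u v : weyl u -> weyl v -> weyl (u *m v)
| weyl_inv u : weyl u -> weyl (invmx u).

Definition word_prod (s : seq 'I_n) : 'M[R]_n := \prod_(i <- s) simple_refl i.

Definition reduced_word (w : 'M[R]_n) (s : seq 'I_n) : Prop :=
  word_prod s = w /\ forall t, word_prod t = w -> (size s <= size t)%N.

Definition coxeter_length (w : 'M[R]_n) (l : nat) : Prop :=
  exists2 s, reduced_word w s & size s = l.

Definition longest_element (w : 'M[R]_n) : Prop :=
  weyl w /\ exists2 l, coxeter_length w l &
    forall u k, weyl u -> coxeter_length u k -> (k <= l)%N.

Definition mx_order (x : 'M[R]_n) (m : nat) : Prop :=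
  [/\ (0 < m)%N, x ^+ m = 1 & forall k, (0 < k)%N -> x ^+ k = 1 -> (m <= k)%N].

(* The word i j i j ... with m letters. *)
Fixpoint alternating (i j : 'I_n) (m : nat) : seq 'I_n :=
  if m is m'.+1 then i :: alternating j i m' else [::].

Definition braid_move (s t : seq 'I_n) : Prop :=
  exists a b i j m,
    [/\ i != j, mx_order (simple_refl i * simple_refl j) m,
        s = a ++ alternating i j m ++ b & t = a ++ alternating j i m ++ b].

Definition G_edge (w : 'M[R]_n) (s t : seq 'I_n) : Prop :=
  [/\ reduced_word w s, reduced_word w t & braid_move s t].

Definition hyperplane (a : 'rV[R]_n) : {vspace 'rV[R]_n} :=
  lker (linfun (mulmxr a^T : 'rV[R]_n -> 'M[R]_1)).

Lemma mem_hyperplane (a x : 'rV[R]_n) : (x \in hyperplane a) = (dot x a == 0).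
Proof.
rewrite memv_ker lfunE /= /dot; apply/eqP/eqP => [->|h]; first by rewrite mxE.
by apply/matrixP => i j; rewrite !ord1 h mxE.
Qed.

Definition L2 : {fset {vspace 'rV[R]_n}} :=
  [fset U in [fset (\bigcap_(a <- enum_fset S) hyperplane a)%VS
               | S : {fset 'rV[R]_n} in fpowerset pos_roots]
  | (n - \dim U == 2)%N].

End TypeD.

Section GraphDiameter.
Variables (T : Type) (vertex : T -> Prop) (edge : T -> T -> Prop).

Inductive walk : nat -> T -> T -> Prop :=
| walk_nil x : walk 0 x x
| walk_cons k x y z : edge x y -> walk k y z -> walk k.+1 x z.

Definition graph_dist (x y : T) (d : nat) : Prop :=
  walk d x y /\ forall k, walk k x y -> (d <= k)%N.

(* In particular any two vertices are at finite distance. *)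
Definition graph_diam (d : nat) : Prop :=
  (exists x y, [/\ vertex x, vertex y & graph_dist x y d]) /\
  (forall x y, vertex x -> vertex y ->
     exists2 k, graph_dist x y k & (k <= d)%N).

End GraphDiameter.

(* Main.v *)
Require Import Defs.
From mathcomp Require Import all_boot all_order all_algebra finmap reals.
From mathcomp Require Import zify ring lra.
From Stdlib Require Import Classical.

(** Let c_k be the word k, k-1, ..., 2, {0, 1}, 2, ..., k, where the commuting
letters 0 and 1 may be taken in either order.  Its prefixes represent the
cosets of W(D_k) in W(D_(k+1)), so multiplying a prefix c on the right by a
letter i has one of three effects: the prefix grows, the prefix shrinks
(impossible in a reduced word), or c i = i' c for a letter i' of W(D_k).  A
reduced word can thus be read from left to right as a path whose steps either
advance in c_k or cross it with a letter of W(D_k).  For a reduced word of w_0,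
counting lengths forces the path to run through all of c_k and to cross it
k(k-1) times, along a reduced word u of the longest element of W(D_k)
([chain_sort], [tight_routes]).

The path can be deformed to one of two extremes: all the crossings first (the
word u c_k) or all of c_k first (the word c_k u', where u' is u with 0 and 1
exchanged).  A crossing letter i passes to the left of the prefix c or to the
right of the remaining suffix of c_k.  Passing a letter of the chain costs one
commutation, except that two letters of c_k are passed by a single braid move,
twice along the whole chain.  So the two deformations together cost 2k - 2
moves for each crossing, plus at most one exchange of 0 and 1, which is needed
when the two middle letters are in the wrong order ([chain_step]); one more
exchange may be needed at the end of each deformation.  Recursing on u in both
cases gives two fixed words T and T' such that every reduced word r satisfies
d(r, T) + d(r, T') <= K with K = n(n-1)^2(n-2)/2 + 2(n-1).  Going from r to s
through T or through T', whichever is shorter, shows that d(r, s) <= K.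

This is the reason for the bound: each move of a crossing letter through the
chain turns over one codimension-two flat, and only the exchanges of 0 and 1
can be wasteful.  To compare K with |L_2| it suffices to exhibit
12 * 'C(n, 4) flats, the intersections of the hyperplanes of two roots
+-e_i + e_j and +-e_k + e_l with {i, j} and {k, l} disjoint ([leq_card_L2]):
the difference K - 12 * 'C(n, 4) = n(n-1)(n-2) + 2(n-1) is less than 4/3 n^3.

That w_0 has length n(n-1) follows from the same sorting procedure: c_k maps
e_k to -e_k, whereas one reflection changes the pairing with (0, 1, ..., n-1)
of a vector +-e_j by at most one, so a prefix of c_k shorter than 2k cannot
replace c_k ([longest_minimal]). *)

Set Implicit Arguments.
Unset Strict Implicit.
Unset Printing Implicit Defensive.

(** * Words and braid moves *)

(** Edges of the diagram of type D: the path 1 - 2 - 3 - ... with 0 attached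
to 2.  Letters are unbounded natural numbers so that words of different ranks
live in one type. *)
Definition linked (i j : nat) : bool :=
  [|| (0 < j) && (i == j.+1), (0 < i) && (j == i.+1),
      (i == 2) && (j == 0) | (i == 0) && (j == 2)].

Definition comm (i j : nat) : bool := (i != j) && ~~ linked i j.

Inductive move : seq nat -> seq nat -> Prop :=
| move_comm a b i j : comm i j -> move (a ++ [:: i, j & b]) (a ++ [:: j, i & b])
| move_braid a b i j :
    linked i j -> move (a ++ [:: i, j, i & b]) (a ++ [:: j, i, j & b]).

(** Costs are kept as upper bounds, so that the estimates below simply add up. *)
Definition within (d : nat) (x y : seq nat) : Prop :=
  exists2 k, k <= d & walk move k x y.

Lemma linkedC i j : linked i j = linked j i.
Proof. by rewrite /linked; lia. Qed.

Lemma commC i j : comm i j = comm j i.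
Proof. by rewrite /comm linkedC eq_sym. Qed.

Lemma move_sym x y : move x y -> move y x.
Proof.
case=> a b i j h; first by apply: move_comm; rewrite commC.
by apply: move_braid; rewrite linkedC.
Qed.

Lemma move_cat a b x y : move x y -> move (a ++ x ++ b) (a ++ y ++ b).
Proof.
case=> c d i j h; rewrite -!catA /= !(catA a).
  exact: move_comm.
exact: move_braid.
Qed.

Lemma move_rev x y : move x y -> move (rev x) (rev y).
Proof.
by case=> a b i j h; rewrite !rev_cat !rev_cons -!cats1 -!catA /=;
  [apply: move_comm; rewrite commC | apply: move_braid].
Qed.

Lemma walk_trans (T : Type) (e : T -> T -> Prop) j k x y z :
  walk e j x y -> walk e k y z -> walk e (j + k) x z.
Proof.
by move=> h; elim: h z => // {}j {}x {}y z' xy _ IH z /IH; apply: walk_cons.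
Qed.

Lemma walk_sym (T : Type) (e : T -> T -> Prop) k x y :
  (forall u v, e u v -> e v u) -> walk e k x y -> walk e k y x.
Proof.
move=> es; elim=> [z|{}k {}x {}y z xy _ IH]; first exact: walk_nil.
rewrite -addn1; apply: walk_trans IH _.
by apply: walk_cons (walk_nil _ _); apply: es.
Qed.

Lemma walk_map (T U : Type) (e : T -> T -> Prop) (e' : U -> U -> Prop)
    (f : T -> U) k x y :
  (forall u v, e u v -> e' (f u) (f v)) -> walk e k x y -> walk e' k (f x) (f y).
Proof.
move=> ef; elim=> [z|{}k {}x {}y z xy _ IH]; first exact: walk_nil.
by apply: walk_cons IH; apply: ef.
Qed.

Lemma within_refl x : within 0 x x.
Proof. by exists 0 => //; apply: walk_nil. Qed.

Lemma within_leq d e x y : d <= e -> within d x y -> within e x y.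
Proof. by move=> de [k kd w]; exists k => //; apply: leq_trans de. Qed.

Lemma within_trans d e x y z :
  within d x y -> within e y z -> within (d + e) x z.
Proof.
by move=> [j jd xy] [k ke yz]; exists (j + k); [exact: leq_add|exact: walk_trans yz].
Qed.

Lemma within_sym d x y : within d x y -> within d y x.
Proof. by move=> [k kd w]; exists k => //; apply: walk_sym w; apply: move_sym. Qed.

Lemma within_map f d x y :
  (forall u v, move u v -> move (f u) (f v)) ->
  within d x y -> within d (f x) (f y).
Proof. by move=> mf [k kd w]; exists k => //; apply: walk_map w. Qed.

Lemma within_cat a b d x y :
  within d x y -> within d (a ++ x ++ b) (a ++ y ++ b).
Proof. by apply: (within_map (f := fun x => a ++ x ++ b)) => u v; apply: move_cat. Qed.

Lemma within_catl a d x y : within d x y -> within d (a ++ x) (a ++ y).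
Proof. by move/(within_cat a [::]); rewrite !cats0. Qed.

Lemma within_catr b d x y : within d x y -> within d (x ++ b) (y ++ b).
Proof. exact: (within_cat [::] b). Qed.

Lemma within_rev d x y : within d x y -> within d (rev x) (rev y).
Proof. by apply: within_map => u v; apply: move_rev. Qed.

Lemma move_size x y : move x y -> size x = size y.
Proof. by case=> *; rewrite !size_cat. Qed.

Lemma move_all P x y : move x y -> all P x = all P y.
Proof.
case=> a b i j _; rewrite !all_cat /=; case: (all P a) => //=;
  by case: (P i); case: (P j).
Qed.

Lemma within_size d x y : within d x y -> size x = size y.
Proof. by case=> k _; elim=> // {}k u v z /move_size -> _ ->. Qed.

Lemma within_all P d x y : within d x y -> all P x = all P y.
Proof. by case=> k _; elim=> // {}k u v z /(move_all P) -> _ ->. Qed.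

Lemma within_comm i j : comm i j -> within 1 [:: i; j] [:: j; i].
Proof.
move=> h; exists 1 => //; apply: walk_cons (walk_nil _ _).
exact: (move_comm [::] [::]).
Qed.

Lemma within_braid i j : linked i j -> within 1 [:: i; j; i] [:: j; i; j].
Proof.
move=> h; exists 1 => //; apply: walk_cons (walk_nil _ _).
exact: (move_braid [::] [::]).
Qed.

Lemma push_comm i c : all (comm i) c -> within (size c) (c ++ [:: i]) (i :: c).
Proof.
elim: c => [_|j c IH /= /andP[ij /IH h]]; first exact: within_refl.
rewrite -addn1; apply: within_trans (within_catl [:: j] h) _.
by apply: (@within_cat [::] c 1 [:: j; i] [:: i; j]); apply: within_comm; rewrite commC.
Qed.

(** The only braid move occurs at the factor i j: there the travelling letter i
turns into j, passing two letters of the word at once. *)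
Lemma push_braid i j x y : linked i j -> all (comm j) x -> all (comm i) y ->
  within (size x + size y).+1
    ((x ++ [:: i, j & y]) ++ [:: i]) (j :: x ++ [:: i, j & y]).
Proof.
move=> ij hx hy.
have -> : (size x + size y).+1 = size y + (1 + size x) by lia.
apply: (@within_trans _ _ _ ((x ++ [:: i; j; i]) ++ y)).
  rewrite -!catA /=; have := within_catl (x ++ [:: i; j]) (push_comm hy).
  by rewrite -!catA.
rewrite -[(x ++ [:: i; j; i]) ++ y]catA.
apply: within_trans (within_cat x y (within_braid ij)) _.
have := within_catr ([:: i, j & y]) (push_comm hx).
by rewrite -!catA.
Qed.

(** Two braid moves, with the travelling letter becoming j in between. *)
Lemma push_double_braid i i' j x y z :
  linked i j -> linked j i' ->
  all (comm i') x -> all (comm j) y -> all (comm i) z ->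
  within (size x + size y + size z + 2)
    ((x ++ [:: j, i' & y] ++ [:: i, j & z]) ++ [:: i])
    (i' :: (x ++ [:: j, i' & y] ++ [:: i, j & z])).
Proof.
move=> ij ji' hx hy hz.
have -> : size x + size y + size z + 2 =
  (size (@nil nat) + size z).+1 + (size x + size y).+1 by move=> /=; lia.
have := within_catl (x ++ [:: j, i' & y]) (@push_braid i j [::] z ij isT hz).
rewrite -!catA /= => h; apply: within_trans h _.
have := within_catr ([:: i, j & z]) (push_braid ji' hx hy).
by rewrite -!catA /= -!catA.
Qed.

(** * The chain of coset representatives of D_k in D_(k+1) *)

Lemma split_nth2 (c : seq nat) m : m.+1 < size c ->
  c = take m c ++ [:: nth 0 c m, nth 0 c m.+1 & drop m.+2 c].
Proof.
by move=> h; rewrite -!drop_nth ?cat_take_drop //; apply: ltnW.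
Qed.

Lemma all_take_nth (P : pred nat) (c : seq nat) m :
  (forall t, t < m -> P (nth 0 c t)) -> m <= size c -> all P (take m c).
Proof.
move=> h hm; apply/(all_nthP 0) => t; rewrite size_takel // => tm.
by rewrite nth_take // h.
Qed.

Lemma all_drop_nth (P : pred nat) (c : seq nat) m :
  (forall t, m <= t < size c -> P (nth 0 c t)) -> all P (drop m c).
Proof.
move=> h; apply/(all_nthP 0) => t; rewrite size_drop => tm.
by rewrite nth_drop h //; lia.
Qed.

(** This form and the next one locate the factors by their positions, so that
for a prefix of a chain every side condition is arithmetic. *)
Lemma push_braid_nth c m i j :
  m.+1 < size c -> nth 0 c m = i -> nth 0 c m.+1 = j -> linked i j ->
  (forall t, t < m -> comm j (nth 0 c t)) ->
  (forall t, m.+2 <= t < size c -> comm i (nth 0 c t)) ->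
  within (size c).-1 (c ++ [:: i]) (j :: c).
Proof.
move=> hm ci cj ij hx hy.
have hm' : m <= size c by lia.
have := push_braid ij (all_take_nth hx hm') (all_drop_nth hy).
rewrite -{1 3}ci -{1 3}cj -split_nth2 // size_takel // size_drop.
by apply: within_leq; lia.
Qed.

Lemma push_double_braid_nth c m m' i i' j :
  m.+1 < m' -> m'.+1 < size c ->
  nth 0 c m = j -> nth 0 c m.+1 = i' -> nth 0 c m' = i -> nth 0 c m'.+1 = j ->
  linked i j -> linked j i' ->
  (forall t, t < m -> comm i' (nth 0 c t)) ->
  (forall t, m.+2 <= t < m' -> comm j (nth 0 c t)) ->
  (forall t, m'.+2 <= t < size c -> comm i (nth 0 c t)) ->
  within (size c).-2 (c ++ [:: i]) (i' :: c).
Proof.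
move=> mm' hm' cj ci' ci cj' ij ji' hx hy hz.
set x := take m c; set y := take (m' - m.+2) (drop m.+2 c).
have hc : c = x ++ [:: j, i' & y] ++ [:: i, j & drop m'.+2 c].
  rewrite [LHS](@split_nth2 c m) ?cj ?ci' //; last by lia.
  congr (_ ++ [:: _, _ & _]); rewrite [LHS](@split_nth2 _ (m' - m.+2)).
    rewrite !nth_drop drop_drop -ci -cj'.
    by congr (_ ++ [:: nth _ _ _, nth _ _ _ & drop _ _]); lia.
  by rewrite size_drop; lia.
have := @push_double_braid i i' j x y (drop m'.+2 c) ij ji'.
rewrite -hc => h; apply: within_leq (h _ _ _).
- rewrite size_drop /y /x !size_takel ?size_drop; lia.
- by apply: all_take_nth hx _; lia.
- apply: all_take_nth => [t tm|]; last by rewrite size_drop; lia.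
  by rewrite nth_drop; apply: hy; lia.
- exact: all_drop_nth.
Qed.

(** The word c_k, with o telling which of 0 and 1 comes first. *)
Definition chain k (o : bool) : seq nat :=
  rev (iota 2 k.-1) ++ [:: nat_of_bool o; nat_of_bool (~~ o)] ++ iota 2 k.-1.

(** The diagram automorphism, which on the letters of W(D_k) is conjugation by the
element of c_k. *)
Definition swap01 i := if i < 2 then 1 - i else i.

Lemma swap01K : involutive swap01.
Proof. by case=> [|[]]. Qed.

Lemma size_chain k o : 0 < k -> size (chain k o) = k.*2.
Proof. by rewrite !size_cat size_rev !size_iota /=; lia. Qed.

Lemma rev_chain k o : rev (chain k o) = chain k (~~ o).
Proof. by rewrite /chain !rev_cat revK negbK -catA. Qed.

Lemma nth_chain k o p : 0 < k -> p < k.*2 -> nth 0 (chain k o) p =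
  if p < k.-1 then k - p else if p == k.-1 then nat_of_bool o
  else if p == k then nat_of_bool (~~ o) else p - k.-1.
Proof.
move=> k0 pk; rewrite /chain !nth_cat size_rev size_iota.
case: ifP => [h|h]; first by rewrite nth_rev ?size_iota // nth_iota; lia.
have [->|h1] := eqVneq p k.-1; first by rewrite subnn.
have [->|h2] := eqVneq p k; first by have -> : k - k.-1 = 1 by lia.
have -> : p - k.-1 = (p - k.+1).+2 by lia.
by rewrite /= nth_iota; lia.
Qed.

Lemma take_chain_eq k o o' p :
  p < k -> take p (chain k o) = take p (chain k o').
Proof. by move=> pk; rewrite !takel_cat // size_rev size_iota; lia. Qed.

Lemma drop_chain_eq k o o' p :
  0 < k -> k < p -> drop p (chain k o) = drop p (chain k o').
Proof.
move=> k0 pk; rewrite !drop_cat size_rev size_iota !ifF //=; try lia.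
Qed.

Lemma take_chain_inj k o o' p : 0 < k -> k <= p <= k.*2 ->
  take p (chain k o) = take p (chain k o') -> o = o'.
Proof.
move=> k0 hp /(congr1 (fun c => nth 0 c k.-1)).
rewrite !nth_take ?nth_chain; try lia.
by rewrite ltnn eqxx; case: o o' => [] [].
Qed.

Lemma within_take_chain k o o' p : 0 < k -> k < p ->
  within 1 (take p (chain k o)) (take p (chain k o')).
Proof.
move=> k0 kp.
have E b : take p (chain k b) = rev (iota 2 k.-1) ++
    [:: nat_of_bool b; nat_of_bool (~~ b)] ++ take (p - k.+1) (iota 2 k.-1).
  rewrite /chain catA take_cat size_cat size_rev size_iota -catA.
  by rewrite ifF /=; [congr (_ ++ [:: _, _ & take _ _])|]; lia.
rewrite !E; apply: within_cat.
by case: o; case: o'; try exact: within_leq (within_refl _); apply: within_comm.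
Qed.

Lemma within_chain k o o' : 0 < k -> within 1 (chain k o) (chain k o').
Proof.
move=> k0; have := @within_take_chain k o o' k.*2 k0.
by rewrite !take_oversize ?size_chain //; apply; lia.
Qed.

Lemma size_take_chain k o p :
  0 < k -> p <= k.*2 -> size (take p (chain k o)) = p.
Proof. by move=> k0 pk; rewrite size_takel // size_chain. Qed.

Lemma nth_take_chain k o p t : 0 < k -> p <= k.*2 -> t < p ->
  nth 0 (take p (chain k o)) t =
  if t < k.-1 then k - t else if t == k.-1 then nat_of_bool o
  else if t == k then nat_of_bool (~~ o) else t - k.-1.
Proof. by move=> k0 pk tp; rewrite nth_take // nth_chain //; lia. Qed.

(** Decides relations between letters at known positions of a chain. *)
Ltac nth_chain_lia :=
  rewrite nth_take_chain; [repeat case: ifP => ?; rewrite ?/comm ?/linked; lia|lia..].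

(** Position p of the chain is at letter k - p on the way down and at
p - k + 1 on the way up; here i lies below what the prefix has reached. *)
Lemma chain_push_comm k p o i : 0 < k -> p + i < k -> p.+1 < k ->
  within p (take p (chain k o) ++ [:: i]) (i :: take p (chain k o)).
Proof.
move=> k0 pi pk.
have := @push_comm i (take p (chain k o)).
rewrite size_take_chain; [|lia..]; apply.
apply/(all_nthP 0) => t; rewrite size_take_chain; [|lia..] => tp.
nth_chain_lia.
Qed.

(** The descending factor i, i-1 of the prefix absorbs the letter i. *)
Lemma chain_push_desc k p o i : p <= k.*2 -> 3 <= i <= k ->
  k.+1 < p + i -> p.+1 < k + i ->
  within p.-1 (take p (chain k o) ++ [:: i]) (i.-1 :: take p (chain k o)).
Proof.
move=> pk ik h1 h2.
have := @push_braid_nth (take p (chain k o)) (k - i) i i.-1.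
rewrite size_take_chain; [|lia..]; apply.
- lia.
- nth_chain_lia.
- nth_chain_lia.
- rewrite /linked; lia.
- move=> t ht; nth_chain_lia.
- move=> t ht; nth_chain_lia.
Qed.

(** The factor 2, o in the middle of the chain absorbs the letter 2. *)
Lemma chain_push_mid k o : 1 < k ->
  within k.-1 (take k (chain k o) ++ [:: 2]) (nat_of_bool o :: take k (chain k o)).
Proof.
move=> k1.
have := @push_braid_nth (take k (chain k o)) (k - 2) 2 (nat_of_bool o).
rewrite size_take_chain; [|lia..]; apply.
- lia.
- nth_chain_lia.
- nth_chain_lia.
- by rewrite /linked; case: o.
- move=> t ht; nth_chain_lia.
- move=> t ht; nth_chain_lia.
Qed.

(** The letter meets the factor i, i+1 on the way up and then i+1, i on the way
down.  For i = 0 or 1 these factors are i, 2 and 2, 1-i, which requires the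
middle letters to be in the order 1-i, i; this is the one place where an
exchange of 0 and 1 may have to be paid for. *)
Lemma chain_push_asc k p o i : p <= k.*2 -> k + i < p -> k.+1 < p ->
  exists o', within p.-1 (take p (chain k o) ++ [:: i])
                         (swap01 i :: take p (chain k o')).
Proof.
move=> pk kip kp; have [i2|i2] := leqP 2 i.
  exists o; apply: (@within_leq p.-2); first by lia.
  have := @push_double_braid_nth (take p (chain k o)) (k - i.+1) (k + i.-1) i i i.+1.
  have -> : swap01 i = i by rewrite /swap01 ltnNge i2.
  rewrite size_take_chain; [|lia..]; apply.
  - lia.
  - lia.
  - nth_chain_lia.
  - nth_chain_lia.
  - nth_chain_lia.
  - nth_chain_lia.
  - rewrite /linked; lia.
  - rewrite /linked; lia.
  - move=> t ht; nth_chain_lia.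
  - move=> t ht; nth_chain_lia.
  - move=> t ht; nth_chain_lia.
exists (i == 0).
have -> : p.-1 = 1 + p.-2 by lia.
apply: within_trans (within_catr _ (@within_take_chain _ _ (i == 0) _ _ _)) _; [lia..|].
have := @push_double_braid_nth (take p (chain k (i == 0))) (k - 2) k i (1 - i) 2.
rewrite /swap01 i2 size_take_chain; [|lia..]; apply.
- lia.
- lia.
- nth_chain_lia.
- nth_chain_lia.
- nth_chain_lia.
- nth_chain_lia.
- rewrite /linked; lia.
- rewrite /linked; lia.
- move=> t ht; nth_chain_lia.
- move=> t ht; nth_chain_lia.
- move=> t ht; nth_chain_lia.
Qed.

(** A chain reversed is a chain, so the moves through suffixes are mirror images
of the moves through prefixes. *)
Lemma chain_push_rev k p o o' i j d : 0 < k -> p <= k.*2 ->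
  within d (take (k.*2 - p) (chain k (~~ o)) ++ [:: i])
           (j :: take (k.*2 - p) (chain k (~~ o'))) ->
  within d (i :: drop p (chain k o)) (drop p (chain k o') ++ [:: j]).
Proof.
move=> k0 pk /within_rev; rewrite rev_cat !rev_cons -!cats1.
have h b : rev (take (k.*2 - p) (chain k (~~ b))) = drop p (chain k b).
  by rewrite -rev_chain -(size_chain b k0) -rev_drop revK.
by rewrite !h.
Qed.

(** What remains of reducedness when words are only compared by braid moves. *)
Definition tight w := forall d x i y, ~ within d w (x ++ [:: i, i & y]).

Lemma tight_within d w w' : within d w w' -> tight w -> tight w'.
Proof. by move=> h tw e x i y /(within_trans h); apply: tw. Qed.

Lemma tight_catl x w : tight (x ++ w) -> tight w.
Proof.
move=> tw d y i z /(within_catl x); rewrite catA; exact: tw.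
Qed.

Lemma tight_catr x w : tight (w ++ x) -> tight w.
Proof.
move=> tw d y i z /(within_catr x); rewrite -catA /=; exact: tw.
Qed.

Lemma take_chainS k o p i : 0 < k -> p < k.*2 -> nth 0 (chain k o) p = i ->
  take p.+1 (chain k o) = take p (chain k o) ++ [:: i].
Proof.
by move=> k0 pk <-; rewrite (take_nth 0) ?size_chain // -cats1.
Qed.

Lemma drop_chainS k o p i : 0 < k -> p < k.*2 -> nth 0 (chain k o) p = i ->
  drop p (chain k o) = i :: drop p.+1 (chain k o).
Proof.
by move=> k0 pk <-; rewrite (drop_nth 0) ?size_chain.
Qed.

(** * Sorting a word into D_k letters and a chain *)

(** The three effects of a letter on a prefix of the chain.  When the letter
crosses, a and b are the costs of moving it through the prefix and through the
remaining suffix.  Either motion may change the order of 0 and 1 in a chain;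
the condition on [take p] says that the order is only prescribed when the part
already read determines it. *)
Inductive chain_step_spec k p o i : Prop :=
| StepUp o' of p < k.*2 & take p (chain k o') = take p (chain k o)
    & nth 0 (chain k o') p = i
| StepDown d x of within d (take p (chain k o) ++ [:: i]) (x ++ [:: i; i])
| StepAcross i' o1 a b of 1 < k & i' < k
    & within a (take p (chain k o) ++ [:: i]) (i' :: take p (chain k o1))
    & (forall o2, take p (chain k o2) = take p (chain k o1) ->
       exists2 o3, take p (chain k o3) = take p (chain k o) &
         within b (i :: drop p (chain k o2)) (drop p (chain k o3) ++ [:: swap01 i']))
    & a + b <= k.*2.-1.

Lemma chain_step k p o i : 0 < k -> p <= k.*2 -> i <= k ->
  chain_step_spec k p o i.
Proof.
move=> k0 pk ik.
have down o' q : p = q.+1 -> nth 0 (chain k o') q = i ->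
    within 1 (take p (chain k o)) (take p (chain k o')) ->
    chain_step_spec k p o i.
  move=> E qi /(within_catr [:: i]) h; apply: (@StepDown k p o i 1 (take q (chain k o'))).
  rewrite E in pk h *; move: h; rewrite (take_chainS k0 pk qi).
  by rewrite -[X in within _ _ X]catA.
have desc : 3 <= i -> k.+1 < p + i -> p.+1 < k + i -> chain_step_spec k p o i.
  move=> i3 h1 h2; have i1k : i.-1 < k by lia.
  apply: (@StepAcross k p o i i.-1 o p.-1 (k.*2 - p).-1) => //; first by lia.
  - by apply: chain_push_desc; lia.
  - move=> o2 E; exists o2 => //; apply: chain_push_rev => //.
    have -> : swap01 i.-1 = i.-1 by rewrite /swap01; case: ifP; lia.
    by apply: chain_push_desc; lia.
  - lia.
have self : within 1 (take p (chain k o)) (take p (chain k o)).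
  exact: within_leq (within_refl _).
(* On the way down, strictly before the middle. *)
have [pk1|pk1] := ltnP p k.-1.
  have [h|h] := ltnP (p + i) k.
    apply: (@StepAcross k p o i i o p (k.*2 - p).-1); [lia|lia| | |lia].
      by apply: chain_push_comm; lia.
    move=> o2 E.
    have [||| o' ho'] := @chain_push_asc k (k.*2 - p) (~~ o2) i; [lia..|].
    exists (~~ o'); first by apply: take_chain_eq; lia.
    by apply: chain_push_rev; rewrite ?negbK.
  have [h1|h1] := eqVneq (p + i) k.
    apply: (@StepUp k p o i o) => //; first by lia.
    by rewrite nth_chain; repeat case: ifP; lia.
  have [h2|h2] := eqVneq (p + i) k.+1.
    apply: (down o p.-1) => //; first by lia.
    by rewrite nth_chain; repeat case: ifP; lia.
  by apply: desc; lia.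
(* All descending letters but neither of the middle ones have been read. *)
have [p1|p1] := eqVneq p k.-1.
  have [i2|i2] := ltnP i 2.
    apply: (@StepUp k p o i (i == 1)); [lia|by apply: take_chain_eq; lia|].
    by rewrite nth_chain; repeat case: ifP; lia.
  have [i3|i3] := eqVneq i 2; last by apply: desc; lia.
  apply: (down o p.-1) => //; first by lia.
  by rewrite nth_chain; repeat case: ifP; lia.
(* Exactly one middle letter, o, has been read. *)
have [p2|p2] := eqVneq p k.
  have [i2|i2] := ltnP i 2.
    have [io|io] := eqVneq i (nat_of_bool o).
      apply: (down o p.-1) => //; first by lia.
      by rewrite nth_chain; repeat case: ifP; lia.
    apply: (@StepUp k p o i o); [lia|by []|].
    by rewrite nth_chain; repeat case: ifP; lia.
  have [i3|i3] := eqVneq i 2; last by apply: desc; lia.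
  subst p i.
  apply: (@StepAcross k k o 2 (nat_of_bool o) o k.-1 k.-1); [lia|lia| | |lia].
    by apply: chain_push_mid; lia.
  move=> o2 E; have -> : o2 = o by apply: take_chain_inj E; lia.
  exists o => //; apply: chain_push_rev => //.
  have -> : k.*2 - k = k by lia.
  have -> : swap01 o = ~~ o by case: (o).
  by apply: chain_push_mid; lia.
have kp : k < p by lia.
(* Both middle letters and no ascending one have been read. *)
have [p3|p3] := eqVneq p k.+1.
  have [i2|i2] := ltnP i 2.
    apply: (down (i == 0) k) => //; last exact: within_take_chain.
    by rewrite nth_chain; repeat case: ifP; lia.
  have [i3|i3] := eqVneq i 2; last by apply: desc; lia.
  apply: (@StepUp k p o i o); [lia|by []|].
  by rewrite nth_chain; repeat case: ifP; lia.
(* On the way up. *)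
have [h|h] := ltnP (k + i) p.
  have [||| o' ho'] := @chain_push_asc k p o i; [lia..|].
  apply: (@StepAcross k p o i (swap01 i) o' p.-1 (k.*2 - p)); [lia| |by []| |lia].
    by rewrite /swap01; case: ifP; lia.
  move=> o2 _; exists o => //; rewrite swap01K (@drop_chain_eq k o2 o) //.
  by apply: chain_push_rev => //; apply: chain_push_comm; lia.
have [h1|h1] := eqVneq (k + i) p.
  apply: (down o p.-1) => //; first by lia.
  by rewrite nth_chain; repeat case: ifP; lia.
have [h2|h2] := eqVneq (k + i) p.+1; last by apply: desc; lia.
apply: (@StepUp k p o i o); [lia|by []|].
by rewrite nth_chain; repeat case: ifP; lia.
Qed.

(** The letters of W(D_k); there are none when k = 1. *)
Definition gen k i := (1 < k) && (i < k).

(** The word r, read from position p of the chain, crosses it along u and ends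
at position p'.  The first deformation moves u to the front, the second one
moves its image under [swap01] to the end; their costs are balanced letter by
letter by [chain_step]. *)
Lemma chain_sort k r p o : 0 < k -> p <= k.*2 -> all (gen k.+1) r ->
  tight (take p (chain k o) ++ r) ->
  exists u p' o' a b o'', [/\ (all (gen k) u /\ p' <= k.*2), p + size r = size u + p',
    within a (take p (chain k o) ++ r) (u ++ take p' (chain k o')),
    take p (chain k o'') = take p (chain k o) /\
    within b (r ++ drop p' (chain k o')) (drop p (chain k o'') ++ map swap01 u)
  & a + b <= size u * k.*2.-1].
Proof.
move=> k0; elim: r p o => [|i r IH] p o pk /=.
  move=> _ _; exists [::], p, o, 0, 0, o; split=> //=; first by rewrite addn0.
    by rewrite cats0; apply: within_refl.
  by split=> //; rewrite cats0; apply: within_refl.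
case/andP=> gi gr tr; have ik : i <= k by move: gi => /andP[].
have Er c : c ++ i :: r = (c ++ [:: i]) ++ r by rewrite -catA.
case: (chain_step o k0 pk ik).
- move=> o1 pk2 E1 n1.
  have E2 : take p.+1 (chain k o1) ++ r = take p (chain k o) ++ i :: r.
    by rewrite (take_chainS k0 pk2 n1) E1 Er.
  have [||| u [p' [o' [a [b [o2 [[gu hp'] hs ha [E3 hb] hab]]]]]]] := IH p.+1 o1 => //.
    by rewrite E2.
  have n2 : nth 0 (chain k o2) p = i.
    have := congr1 (fun c => nth 0 c p) E3.
    by rewrite !nth_take // n1.
  exists u, p', o', a, b, o2; split=> //; first by lia.
    by rewrite -E2.
  split; last by rewrite (drop_chainS k0 pk2 n2) /=; apply: (within_catl [:: i]).
  rewrite -E1; have := congr1 (take p) E3.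
  by rewrite !take_takel // leqnSn.
- move=> d x /(within_catr r) h; case: (tr d x i r).
  by rewrite Er; move: h; rewrite -!catA.
- move=> i' o1 a0 b0 k1 i'k ha0 hb0 hab0.
  have ha0r := within_catr r ha0.
  have tr1 : tight (take p (chain k o1) ++ r).
    apply: (@tight_catl [:: i']); apply: tight_within tr.
    by rewrite Er; apply: ha0r.
  have [||| u [p' [o' [a [b [o2 [[gu hp'] hs ha [E3 hb] hab]]]]]]] := IH p o1 => //.
  have [o3 E4 hb3] := hb0 _ E3.
  exists (i' :: u), p', o', (a0 + a), (b + b0), o3; split.
  + by rewrite /= gu /gen k1 i'k.
  + by move=> /=; lia.
  + rewrite Er; apply: within_trans ha0r _.
    exact: (within_catl [:: i'] ha).
  + split=> //; apply: within_trans (within_catl [:: i] hb) _.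
    by have := within_catr (map swap01 u) hb3; rewrite -catA.
  + rewrite /= mulSn; lia.
Qed.

(** The two extreme reduced words of the longest element of W(D_n): the chain of
the highest rank comes last, respectively first, and so on recursively. *)
Fixpoint longest_chain_last n : seq nat :=
  if n is k.+1 then longest_chain_last k ++ (if k is 0 then [::] else chain k true) else [::].

Fixpoint longest_chain_first n : seq nat :=
  if n is k.+1 then
    (if k is 0 then [::] else chain k true) ++ map swap01 (longest_chain_first k)
  else [::].

(** For the passage from D_k to D_(k+1): k(k-1) crossings, each of cost at most
2k - 1, and the adjustment of the middle letters of the final chain in each of
the two routes. *)
Fixpoint route_bound n : nat :=
  if n is k.+1 then
    (if k is 0 then 0 else route_bound k + k * k.-1 * k.*2.-1 + 2) else 0.

Lemma move_swap01 x y : move x y -> move (map swap01 x) (map swap01 y).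
Proof.
have fi i j : (swap01 i == swap01 j) = (i == j) by apply: inj_eq; apply: inv_inj swap01K.
have fl i j : linked (swap01 i) (swap01 j) = linked i j.
  by rewrite /linked /swap01; do 2 case: ifP; lia.
case=> a b i j h; rewrite !map_cat /=.
  by apply: move_comm; rewrite /comm fl fi.
by apply: move_braid; rewrite fl.
Qed.

(** A prefix of c_k has at most 2k letters, which bounds the size of r by
induction; equality forces the full chain and a word u of maximal size, to
which the induction applies. *)
Lemma tight_routes n r : 0 < n -> all (gen n) r -> tight r ->
  size r <= n * n.-1 /\
  (size r = n * n.-1 -> exists a b,
     [/\ within a r (longest_chain_last n), within b r (longest_chain_first n) & a + b <= route_bound n]).
Proof.
elim: n r => // -[|k] IH r _ gr tr.
  by case: r gr tr => [|i r] //= _ _; split=> // _; exists 0, 0; split=> //; exact: within_refl.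
have := @chain_sort k.+1 r 0 true isT isT gr; rewrite take0 => /(_ tr).
case=> u [p [o [a [b [o2 [[gu hp] hs ha [_ hb] hab]]]]]].
rewrite /= in ha; rewrite drop0 in hb.
have tu : tight u.
  by apply: (@tight_catr (take p (chain k.+1 o))); apply: tight_within ha tr.
have [su ru] := IH u isT gu tu.
rewrite add0n in hs; rewrite -!pred_Sn in su ru *.
split=> [|sr]; first by nia.
have pE : p = k.+1.*2 by nia.
have suE : size u = k.+1 * k by nia.
have [a' [b' [ha' hb' hab']]] := ru suE.
exists (a + (a' + 1)), (b + (1 + b')); split.
- rewrite pE take_oversize ?size_chain // in ha; apply: within_trans ha _.
  apply: within_trans (within_catr _ ha') _; rewrite [longest_chain_last _]/=.
  by apply: within_catl; apply: within_chain.
- rewrite pE drop_oversize ?size_chain // cats0 in hb.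
  apply: within_trans hb _.
  apply: within_trans (within_catr _ (within_chain o2 true _)) _ => //.
  by apply: (within_catl (chain k.+1 true)); apply: within_map hb' => x y; apply: move_swap01.
- by rewrite [route_bound _]/= -/(route_bound k.+1) -suE; lia.
Qed.

Lemma route_boundE n : 0 < n -> 2 * route_bound n = n.-1 ^ 2 * (n * (n - 2)) + 4 * n.-1.
Proof.
elim: n => // -[|[|k]] // IH _.
rewrite [route_bound _]/= -/(route_bound k.+2) 2!mulnDr IH //=.
by rewrite !subSS !subn0; nia.
Qed.

(** * Reflections *)

Import Order.TTheory GRing.Theory Num.Theory.
Local Open Scope ring_scope.

Section Refl.
Variables (R : realType) (n : nat).
Implicit Types (x a b : 'rV[R]_n).
Local Notation dot := (@dot R n).
Local Notation evec := (evec R n).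

Lemma dotE x a : dot x a = \sum_j x 0 j * a 0 j.
Proof. by rewrite /Defs.dot mxE; apply: eq_bigr => j _; rewrite mxE. Qed.

Lemma dotC x a : dot x a = dot a x.
Proof. by rewrite !dotE; apply: eq_bigr => j _; rewrite mulrC. Qed.

Lemma dotDl x y a : dot (x + y) a = dot x a + dot y a.
Proof. by rewrite /Defs.dot mulmxDl mxE. Qed.

Lemma dotNl x a : dot (- x) a = - dot x a.
Proof. by rewrite /Defs.dot mulNmx mxE. Qed.

Lemma dotZl c x a : dot (c *: x) a = c * dot x a.
Proof. by rewrite /Defs.dot -scalemxAl mxE. Qed.

Lemma dotDr x y a : dot a (x + y) = dot a x + dot a y.
Proof. by rewrite dotC dotDl !(dotC _ a). Qed.

Lemma dotNr x a : dot a (- x) = - dot a x.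
Proof. by rewrite dotC dotNl dotC. Qed.

Lemma dot_evec_r x (i : 'I_n) : dot x (evec i) = x 0 i.
Proof.
rewrite dotE (bigD1 i) //= mxE eqxx mulr1 big1 ?addr0 // => j ji.
by rewrite mxE val_eqE (negbTE ji) mulr0.
Qed.

Lemma dot_evec i j : (j < n)%N -> dot (evec i) (evec j) = (i == j)%:R.
Proof. by move=> jn; rewrite (@dot_evec_r _ (Ordinal jn)) mxE eq_sym. Qed.

(** The normalization of the roots of type D, for which the coefficient of the
reflection formula is the scalar product itself. *)
Definition sqnorm2 a := dot a a = 2.

Lemma mul_refl a x : sqnorm2 a -> x *m reflection a = x - dot x a *: a.
Proof.
by move=> aa; rewrite mul_reflection aa mulrAC divff ?mul1r // pnatr_eq0.
Qed.

Lemma eq_mulmx_row (A B : 'M[R]_n) :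
  (forall x : 'rV_n, x *m A = x *m B) -> A = B.
Proof. by move=> h; apply/row_matrixP => i; rewrite !rowE h. Qed.

Lemma reflK a : sqnorm2 a -> reflection a *m reflection a = 1%:M.
Proof.
move=> aa; apply: eq_mulmx_row => x.
rewrite mulmxA mulmx1 !mul_refl // dotDl dotNl dotZl aa.
by apply/rowP => j; rewrite !mxE; ring.
Qed.

Lemma refl_comm a b : sqnorm2 a -> sqnorm2 b -> dot a b = 0 ->
  reflection a *m reflection b = reflection b *m reflection a.
Proof.
move=> aa bb ab; apply: eq_mulmx_row => x.
rewrite !mulmxA !mul_refl // !(dotDl, dotNl, dotZl) (dotC b) ab.
by apply/rowP => j; rewrite !mxE; ring.
Qed.

Lemma refl_braid a b : sqnorm2 a -> sqnorm2 b -> dot a b = -1 ->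
  reflection a *m reflection b *m reflection a =
  reflection b *m reflection a *m reflection b.
Proof.
move=> aa bb ab; apply: eq_mulmx_row => x.
rewrite !mulmxA !mul_refl // !(dotDl, dotNl, dotZl) (dotC b) ab aa bb.
by apply/rowP => j; rewrite !mxE; ring.
Qed.

(** The product is not the identity since it does not fix a. *)
Lemma refl_order2 a b : sqnorm2 a -> sqnorm2 b -> dot a b = 0 ->
  mx_order (reflection a * reflection b) 2.
Proof.
move=> aa bb ab; split=> // [|[|[|//]] // _].
  by rewrite expr2 -!mulmxE {2}refl_comm // mulmxA -(mulmxA (reflection a)) reflK // mulmx1 reflK.
rewrite expr1 -mulmxE => /(congr1 (fun M => dot (a *m M) a)).
rewrite mulmx1 mulmxA !mul_refl // !(dotDl, dotNl, dotZl) (dotC b) ab aa.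
lra.
Qed.

(** If the product, which has cube 1, had square 1, it would be 1; but it does
not fix a. *)
Lemma refl_order3 a b : sqnorm2 a -> sqnorm2 b -> dot a b = -1 ->
  mx_order (reflection a * reflection b) 3.
Proof.
move=> aa bb ab.
have h3 : (reflection a * reflection b) ^+ 3 = 1.
  apply: eq_mulmx_row => x; rewrite 2!exprS expr1 -!mulmxE !mulmxA.
  rewrite !mul_refl // !(dotDl, dotNl, dotZl) (dotC b) ab aa bb.
  by apply/rowP => j; rewrite mulmx1 !mxE; ring.
have h1 : reflection a * reflection b <> 1.
  rewrite -mulmxE => /(congr1 (fun M => dot (a *m M) a)).
  rewrite mulmx1 mulmxA !mul_refl // !(dotDl, dotNl, dotZl) (dotC b) ab aa.
  lra.
split; [by []|exact: h3|case=> [|[|[|k]]] // _].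
by move=> h2; move: h3; rewrite exprS h2 mulr1 => /h1.
Qed.

Definition nat_root (i : nat) : 'rV[R]_n :=
  if i == 0%N then evec 0 + evec 1 else evec i - evec i.-1.

Lemma dot_nat_root i j : (1 < n)%N -> (i < n)%N -> (j < n)%N ->
  dot (nat_root i) (nat_root j) =
  if i == j then 2 else if linked i j then -1 else 0.
Proof.
move=> n1 iN jN.
have [hi1 hj1] : (i.-1 < n)%N /\ (j.-1 < n)%N by lia.
have n0 : (0 < n)%N by lia.
rewrite /nat_root; case: (posnP i) => [i0|i0]; case: (posnP j) => [j0|j0];
  rewrite ?i0 ?j0 ?(gtn_eqF i0) ?(gtn_eqF j0) /=;
  rewrite !(dotDl, dotNl, dotDr, dotNr) !dot_evec //.
- by rewrite /=; ring.
- have -> : (0 == j)%N = false by lia.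
  have [->|j1] := eqVneq j 1%N; first by rewrite /=; ring.
  have [->|j2] := eqVneq j 2%N; first by rewrite /=; ring.
  have -> : (0 == j.-1)%N = false by lia.
  have -> : (1 == j.-1)%N = false by lia.
  have -> : linked 0 j = false by rewrite /linked; lia.
  by rewrite /=; ring.
- have -> : (i == 0)%N = false by lia.
  have [->|j1] := eqVneq i 1%N; first by rewrite /=; ring.
  have [->|j2] := eqVneq i 2%N; first by rewrite /=; ring.
  have -> : (i.-1 == 0)%N = false by lia.
  have -> : (i.-1 == 1)%N = false by lia.
  have -> : linked i 0 = false by rewrite /linked; lia.
  by rewrite /=; ring.
- have [->|ij] := eqVneq i j.
    rewrite !eqxx; have -> : (j == j.-1)%N = false by lia.
    have -> : (j.-1 == j)%N = false by lia.
    by rewrite /=; ring.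
  have -> : (i.-1 == j.-1)%N = false by lia.
  have -> : linked i j = (i == j.-1) || (i.-1 == j) by rewrite /linked; lia.
  have [ij1|ij1] := eqVneq i j.-1.
    have -> : (i.-1 == j)%N = false by lia.
    by rewrite /=; ring.
  by case: (i.-1 == j)%N => /=; ring.
Qed.

Definition nat_refl i := reflection (nat_root i).
Definition nat_prod s := \prod_(i <- s) nat_refl i.

Definition below (s : seq nat) := all (fun i => i < n)%N s.

Section Gt1.
Hypothesis n1 : (1 < n)%N.

Lemma sqnorm2_nat_root i : (i < n)%N -> sqnorm2 (nat_root i).
Proof. by move=> iN; rewrite /sqnorm2 dot_nat_root // eqxx. Qed.

Lemma nat_prod_cat s t : nat_prod (s ++ t) = nat_prod s *m nat_prod t.
Proof. by rewrite /nat_prod big_cat mulmxE. Qed.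

Lemma nat_prod_cons i t : nat_prod (i :: t) = nat_refl i *m nat_prod t.
Proof. by rewrite /nat_prod big_cons mulmxE. Qed.

Lemma nat_prod_nil : nat_prod [::] = 1%:M.
Proof. by rewrite /nat_prod big_nil. Qed.

Lemma nat_prod_move s t : move s t -> below s -> nat_prod s = nat_prod t.
Proof.
case=> a b i j h; rewrite /below all_cat => /and4P[_ iN jN _];
  rewrite !nat_prod_cat !nat_prod_cons; congr (_ *m _); rewrite !mulmxA;
  congr (_ *m _); rewrite /nat_refl.
  apply: refl_comm; [exact: sqnorm2_nat_root|exact: sqnorm2_nat_root|].
  by rewrite dot_nat_root //; case/andP: h => /negbTE -> /negbTE ->.
apply: refl_braid; [exact: sqnorm2_nat_root|exact: sqnorm2_nat_root|].
rewrite dot_nat_root // h ifF //.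
by move: h; rewrite /linked; lia.
Qed.

Lemma nat_prod_within d s t : within d s t -> below s -> nat_prod s = nat_prod t.
Proof.
case=> k _; elim=> // {}k x y z xy _ IH bx.
rewrite (nat_prod_move xy) // IH //.
by rewrite /below -(move_all _ xy).
Qed.

Lemma nat_prod_rev s : below s -> nat_prod s *m nat_prod (rev s) = 1%:M.
Proof.
elim: s => [_|i s IH /= /andP[iN bs]]; first by rewrite nat_prod_nil mulmx1.
rewrite rev_cons -cats1 nat_prod_cat !nat_prod_cons nat_prod_nil mulmx1.
by rewrite mulmxA -(mulmxA _ (nat_prod s)) IH // mulmx1 reflK //; exact: sqnorm2_nat_root.
Qed.

Lemma nat_prod_cancel s i t : (i < n)%N ->
  nat_prod (s ++ [:: i, i & t]) = nat_prod (s ++ t).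
Proof.
move=> iN; rewrite !nat_prod_cat !nat_prod_cons; congr (_ *m _).
by rewrite mulmxA reflK ?mul1mx //; exact: sqnorm2_nat_root.
Qed.

(** Pairing with this vector is 1 on every simple root. *)
Definition height : 'rV[R]_n := \row_j j%:R.

Lemma dot_evec_height j : (j < n)%N -> dot (evec j) height = j%:R.
Proof. by move=> jn; rewrite dotC (@dot_evec_r _ (Ordinal jn)) mxE. Qed.

Definition signed_evec x := exists2 j, (j < n)%N & x = evec j \/ x = - evec j.

Lemma dot_root_height i : (i < n)%N -> dot (nat_root i) height = 1.
Proof.
move=> iN; rewrite /nat_root; have [_|i0] := eqVneq i 0%N.
  by rewrite dotDl !dot_evec_height ?add0r //; lia.
rewrite dotDl dotNl !dot_evec_height; try lia.
by case: i i0 {iN} => // i _; rewrite -natr1 /=; ring.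
Qed.

Lemma evec_refl i j : (i < n)%N -> (j < n)%N ->
  evec j *m nat_refl i =
  if i == 0%N then
    if j == 0%N then - evec 1 else if j == 1%N then - evec 0 else evec j
  else if j == i then evec i.-1 else if j == i.-1 then evec i else evec j.
Proof.
move=> iN jN; rewrite (mul_refl _ (sqnorm2_nat_root iN)) dotC /nat_root.
have [_|i0] := eqVneq i 0%N.
  rewrite dotDl !dot_evec // ![_ == j]eq_sym.
  have [->|j0] := eqVneq j 0%N; first by rewrite /= addr0 scale1r opprD addNKr.
  have [->|j1] := eqVneq j 1%N; first by rewrite /= add0r scale1r opprD addrC subrK.
  by rewrite addr0 scale0r subr0.
rewrite dotDl dotNl !dot_evec // ![_ == j]eq_sym.
have [->|ji] := eqVneq j i.
  have -> : (i == i.-1)%N = false by lia.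
  by rewrite subr0 scale1r subKr.
have [->|ji1] := eqVneq j i.-1; last by rewrite subr0 scale0r subr0.
by rewrite sub0r scaleN1r opprK addrC subrK.
Qed.

(** The reflection subtracts a multiple of a simple root whose coefficient is
-1, 0 or 1, and every simple root has height 1. *)
Lemma signed_evec_refl i x : (i < n)%N -> signed_evec x ->
  signed_evec (x *m nat_refl i) /\
  `|dot (x *m nat_refl i) height - dot x height| <= 1.
Proof.
move=> iN [j jN xj]; split.
  have [j' j'N hj'] : exists2 j', (j' < n)%N &
      evec j *m nat_refl i = evec j' \/ evec j *m nat_refl i = - evec j'.
    rewrite evec_refl //; case: ifP => i0.
      case: ifP => j0; first by exists 1%N => //; right.
      case: ifP => j1; first by exists 0%N; [lia|right].
      by exists j => //; left.
    case: ifP => j0; first by exists i.-1; [lia|left].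
    case: ifP => j1; first by exists i => //; left.
    by exists j => //; left.
  exists j' => //; case: xj hj' => -> [h|h]; rewrite ?mulNmx h ?opprK; tauto.
rewrite (mul_refl _ (sqnorm2_nat_root iN)) dotDl dotNl dotZl dot_root_height // mulr1.
rewrite addrAC subrr add0r normrN.
have h : `|dot (evec j) (nat_root i)| <= 1.
  rewrite dotC /nat_root; case: ifP => i0.
    rewrite dotDl !dot_evec //.
    by case: (0 =P j)%N => [<-|_] /=; [|case: (1 == j)%N];
      rewrite ?addr0 ?add0r ?normr1 ?normr0.
  rewrite dotDl dotNl !dot_evec //.
  by case: (i == j); case: (i.-1 == j); rewrite /= ?subrr ?subr0 ?sub0r ?normrN ?normr1 ?normr0.
by case: xj => ->; rewrite ?dotNl ?normrN.
Qed.

Lemma signed_evec_prod s x : below s -> signed_evec x ->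
  `|dot (x *m nat_prod s) height - dot x height| <= (size s)%:R.
Proof.
elim: s x => [|i s IH] x /=.
  by rewrite nat_prod_nil mulmx1 subrr normr0.
case/andP=> iN bs sx; have [sx1 h1] := signed_evec_refl iN sx.
have := IH _ bs sx1; rewrite nat_prod_cons mulmxA -natr1 => h2.
apply: le_trans (lerD h2 h1); apply: le_trans (ler_normD _ _).
by rewrite addrA subrK.
Qed.

Lemma evec_fixed_by_gen k u : all (gen k) u -> (k < n)%N -> evec k *m nat_prod u = evec k.
Proof.
elim: u => [_ _|i u IH /= /andP[/andP[k1 ik] gu] kN]; first by rewrite nat_prod_nil mulmx1.
rewrite nat_prod_cons mulmxA evec_refl //; last by lia.
rewrite -[RHS]IH //.
by repeat case: ifP => //; lia.
Qed.

Lemma evec_desc k : (0 < k < n)%N ->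
  evec k *m nat_prod (rev (iota 2 k.-1)) = evec 1.
Proof.
case: k => // k; elim: k => [|k IH] kN; first by rewrite nat_prod_nil mulmx1.
rewrite -[k.+2.-1]addn1 iotaD rev_cat nat_prod_cons mulmxA evec_refl //; try lia.
rewrite addnC addn2 eqxx /= IH //; lia.
Qed.

Lemma evec_asc k : (0 < k < n)%N ->
  evec 1 *m nat_prod (iota 2 k.-1) = evec k.
Proof.
case: k => // k; elim: k => [|k IH] kN; first by rewrite nat_prod_nil mulmx1.
rewrite -[k.+2.-1]addn1 iotaD nat_prod_cat mulmxA IH; last by lia.
rewrite nat_prod_cons nat_prod_nil mulmx1 evec_refl; [|lia..].
by repeat case: ifP => //; lia.
Qed.

Lemma evec_chain k o : (0 < k < n)%N -> evec k *m nat_prod (chain k o) = - evec k.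
Proof.
move=> kN; rewrite /chain !nat_prod_cat !mulmxA evec_desc //.
have -> : evec 1 *m nat_prod [:: nat_of_bool o; nat_of_bool (~~ o)] = - evec 1.
  rewrite !nat_prod_cons nat_prod_nil mulmx1 mulmxA.
  by case: o; rewrite /= !(evec_refl, mulNmx) //=; lia.
by rewrite mulNmx evec_asc.
Qed.

End Gt1.
End Refl.

(** * The length of the longest element *)

Lemma all_gen_chain k o : (0 < k)%N -> all (gen k.+1) (chain k o).
Proof.
move=> k0; apply/(all_nthP 0%N) => t; rewrite size_chain // => tk.
by rewrite nth_chain // /gen; repeat case: ifP; lia.
Qed.

Lemma all_genS k u : all (gen k) u -> all (gen k.+1) u.
Proof. by apply: sub_all => i; rewrite /gen; lia. Qed.

Lemma all_gen_longest m : all (gen m) (longest_chain_last m).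
Proof.
elim: m => //= -[|k] IH //; rewrite all_cat all_genS //=.
exact: all_gen_chain.
Qed.

Lemma size_longest m : size (longest_chain_last m) = (m * m.-1)%N.
Proof.
elim: m => // -[|k] IH //.
rewrite [longest_chain_last _]/= size_cat -/(longest_chain_last k.+1) IH size_chain //= -?pred_Sn.
nia.
Qed.

Section Length.
Variables (R : realType) (n : nat).
Hypothesis n1 : (1 < n)%N.
Local Notation nat_prod := (@nat_prod R n).

Lemma gen_below m s : (m <= n)%N -> all (gen m) s -> below n s.
Proof. by move=> mn; apply: sub_all => i; rewrite /gen; lia. Qed.

Lemma nat_prod_inj_r k o t t' : (0 < k < n)%N ->
  nat_prod t *m nat_prod (chain k o) = nat_prod t' *m nat_prod (chain k o) ->
  nat_prod t = nat_prod t'.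
Proof.
move=> kn /(congr1 (fun M => M *m nat_prod (rev (chain k o)))).
have bc : below n (chain k o).
  by apply: (@gen_below k.+1); [lia|apply: all_gen_chain; lia].
by rewrite -!mulmxA nat_prod_rev // !mulmx1.
Qed.

(** If t is not tight, a factor i i can be deleted after braid moves.  If it is,
it sorts as u followed by a prefix of the chain.  Since u fixes e_k, this prefix maps e_k to -e_k, which takes 2k
letters; cancelling the chain leaves u with the product of the longest word of
lower rank. *)
Lemma longest_minimal m t : (0 < m <= n)%N -> all (gen m) t ->
  nat_prod t = nat_prod (longest_chain_last m) -> (m * m.-1 <= size t)%N.
Proof.
elim: m t => // -[|k] IH t mn; first by [].
have [N] := ubnP (size t); elim: N t => // N IHt t tN gt E.
have bt := gen_below (proj2 (andP mn)) gt.
have [tt|ntt] := classic (tight t); last first.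
  have [d [x [i [y h]]]] : exists d x i y, within d t (x ++ [:: i, i & y]).
    apply: NNPP => nh; apply: ntt => d x i y h; apply: nh.
    by exists d, x, i, y.
  have gx := gt; rewrite (within_all _ h) all_cat /= in gx.
  case/and4P: gx => gx gi _ gy.
  have := IHt (x ++ y); move: tN; rewrite (within_size h) !size_cat /= => tN.
  have iN : (i < n)%N by move: gi; rewrite /gen; lia.
  rewrite all_cat gx gy -(nat_prod_cancel R n1 _ _ iN) -(nat_prod_within R n1 h) //.
  by move=> IHxy; apply: leq_trans (IHxy _ isT E) _; lia.
have := @chain_sort k.+1 t 0%N true isT isT gt; rewrite take0 => /(_ tt).
case=> u [p [o [a [b [o2 [[gu hp] hs ha _ _]]]]]].
have kn : (0 < k.+1 < n)%N by lia.
have bu : below n u by apply: gen_below gu; lia.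
have Et : nat_prod u *m nat_prod (take p (chain k.+1 o)) =
    nat_prod (longest_chain_last k.+1) *m nat_prod (chain k.+1 true).
  by rewrite -!nat_prod_cat // -(nat_prod_within R n1 ha).
have bc : below n (chain k.+1 o).
  by apply: (@gen_below k.+2); [lia|apply: all_gen_chain].
have bp : below n (take p (chain k.+1 o)).
  by move: bc; rewrite /below -{1}(cat_take_drop p (chain _ _)) all_cat => /andP[].
have pE : p = k.+1.*2.
  have := congr1 (mulmx (evec R n k.+1)) Et; rewrite !mulmxA.
  have kN := proj2 (andP kn).
  rewrite (evec_fixed_by_gen R n1 gu kN) (evec_fixed_by_gen R n1 (all_gen_longest _) kN).
  rewrite evec_chain // => Ep.
  have := @signed_evec_prod R n n1 _ (evec R n k.+1) bp.
  rewrite Ep size_take_chain // dotNl dot_evec_height; last by lia.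
  rewrite -opprD normrN -natrD normr_nat ler_nat => h.
  suff : (k.+1 + k.+1 <= p)%N by lia.
  by apply: h; exists k.+1; [lia|left].
rewrite pE take_oversize ?size_chain // in Et.
rewrite (nat_prod_within R n1 (within_chain o true _)) // in Et.
have {}Et := nat_prod_inj_r kn Et.
have := IH u _ gu Et.
by rewrite add0n in hs; rewrite hs pE /=; nia.
Qed.

End Length.

(** * Codimension-two flats *)

Section Flats.
Variables (R : realType) (n : nat).
Local Notation evec := (evec R n).

(** Rank-nullity for the functional x |-> <x, a> on V, which is onto. *)
Lemma dim_cap_hyperplane (V : {vspace 'rV[R]_n}) x a :
  x \in V -> dot x a != 0 -> (\dim (V :&: hyperplane a)).+1 = \dim V.
Proof.
move=> xV xa; set f := linfun (mulmxr a^T : 'rV[R]_n -> 'M[R]_1).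
rewrite -(limg_ker_dim f V) -addn1; congr addn; apply/eqP.
rewrite eqn_leq; apply/andP; split.
  rewrite lt0n dimv_eq0; apply: contraNneq xa => fV.
  have := memv_img f xV; rewrite fV memv0 lfunE /= /dot => /eqP ->.
  by rewrite mxE.
by apply: leq_trans (dimvS (subvf _)) _; rewrite dimvf /dim /=.
Qed.

(** The positive roots e_j - e_i (s true) and e_j + e_i (s false), for i < j. *)
Definition pair_root i j (s : bool) : 'rV[R]_n := evec j + (-1) ^+ s *: evec i.

Lemma dot_evec_pair m i j s : (i < n)%N -> (j < n)%N ->
  dot (evec m) (pair_root i j s) = (m == j)%:R + (-1) ^+ s * (m == i)%:R.
Proof. by move=> iN jN; rewrite dotDr dotC [dot _ (_ *: _)]dotC dotZl !(dotC _ (evec m)) !dot_evec. Qed.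

Lemma pair_root_in i j s : (i < j < n)%N -> pair_root i j s \in pos_roots R n.
Proof.
move=> /andP[ij jN]; have iN := ltn_trans ij jN.
rewrite in_fsetU; apply/orP; case: s; [left|right].
  apply/imfsetP; exists (Ordinal iN, Ordinal jN) => //=.
  by rewrite /pair_root scaleN1r.
apply/imfsetP; exists (Ordinal iN, Ordinal jN) => //=.
by rewrite /pair_root scale1r.
Qed.

Definition flat i j s k l t := (hyperplane (pair_root i j s) :&: hyperplane (pair_root k l t))%VS.

Definition disjoint_pairs i j k l :=
  [&& (i < j < n)%N, (k < l < n)%N, i != k, i != l, j != k & j != l].

(** The two roots are orthogonal, so the second one is a vector of the first
hyperplane outside its own. *)
Lemma flat_in_L2 i j s k l t : disjoint_pairs i j k l -> flat i j s k l t \in L2 R n.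
Proof.
case/and5P=> ijn kln ik il /andP[jk jl].
set a := pair_root i j s; set b := pair_root k l t.
have ss u : ((-1) ^+ u * (-1) ^+ u = 1 :> R) by rewrite -expr2 sqrr_sign.
have aa : dot a a = 2.
  rewrite {1}/a /pair_root dotDl dotZl !dot_evec_pair; try lia.
  have -> : (j == i) = false by lia.
  have -> : (i == j) = false by lia.
  by rewrite !eqxx mulr0 addr0 add0r mulr1 ss.
have bb : dot b b = 2.
  rewrite {1}/b /pair_root dotDl dotZl !dot_evec_pair; try lia.
  have -> : (l == k) = false by lia.
  have -> : (k == l) = false by lia.
  by rewrite !eqxx mulr0 addr0 add0r mulr1 ss.
have ab : dot b a = 0.
  rewrite {1}/b /pair_root dotDl dotZl !dot_evec_pair; try lia.
  have -> : (l == j) = false by lia.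
  have -> : (k == j) = false by lia.
  have -> : (l == i) = false by lia.
  have -> : (k == i) = false by lia.
  by rewrite !(mulr0, addr0).
have nab : a != b.
  by apply/eqP => E; move: ab; rewrite -E aa => /eqP; rewrite pnatr_eq0.
rewrite !inE; apply/andP; split.
  apply/imfsetP; exists [fset a; b]%fset => /=.
    rewrite fpowersetE; apply/fsubsetP => x; rewrite in_fset2 => /orP[] /eqP ->;
      exact: pair_root_in.
  by rewrite big_fsetU1 ?inE //= big_seq_fset1.
have b0 : b \in hyperplane a by rewrite mem_hyperplane ab.
have := @dim_cap_hyperplane (hyperplane a) b b b0; rewrite bb pnatr_eq0 => /(_ isT).
have := @dim_cap_hyperplane fullv a a (memvf _); rewrite aa pnatr_eq0 => /(_ isT).
rewrite capfv dimvf /dim /= mul1n -/(flat i j s k l t) => d1 d2.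
by apply/eqP; move: d1 d2; move: (\dim _) (\dim _) => u v; lia.
Qed.

Lemma flat_sub_hyperplane i j s k l t c :
  (flat i j s k l t <= hyperplane c)%VS ->
  forall x, dot x (pair_root i j s) = 0 -> dot x (pair_root k l t) = 0 -> dot x c = 0.
Proof.
move=> /subvP h x xa xb; apply/eqP; rewrite -mem_hyperplane; apply: h.
by rewrite memv_cap !mem_hyperplane xa xb eqxx.
Qed.

Lemma flatC i j s k l t : flat i j s k l t = flat k l t i j s.
Proof. exact: capvC. Qed.

Lemma disjoint_pairsC i j k l : disjoint_pairs i j k l = disjoint_pairs k l i j.
Proof. by rewrite /disjoint_pairs; lia. Qed.

(** The vector e_i -+ e_j lies in the flat, so it must be orthogonal to the root
of indices m, m'; this fixes both its support and its sign. *)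
Lemma flat_root_in_block i j s k l t m m' u :
  disjoint_pairs i j k l -> (m < m' < n)%N -> (m == i) || (m == j) ->
  (flat i j s k l t <= hyperplane (pair_root m m' u))%VS ->
  [/\ m = i, m' = j & u = s].
Proof.
case/and5P=> ijn kln ik il /andP[jk jl] mm' mij /flat_sub_hyperplane h.
have := h (evec i - (-1) ^+ s *: evec j).
rewrite !dotDl !dotNl !dotZl !dot_evec_pair; try lia.
have -> : (i == j) = false by lia.
have -> : (j == i) = false by lia.
rewrite (negbTE ik) (negbTE il) (negbTE jk) (negbTE jl) !eqxx.
rewrite !(mulr0, addr0, add0r, mulr1, oppr0) subrr => /(_ erefl erefl).
have s0 : (-1) ^+ s != 0 :> R by rewrite signr_eq0.
have u0 : (-1) ^+ u != 0 :> R by rewrite signr_eq0.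
have [mi|mi] := eqVneq i m.
  have -> : (i == m') = false by lia.
  have -> : (j == m) = false by lia.
  rewrite mulr1 add0r mulr0 addr0; have [->|jm'] := eqVneq j m'.
    rewrite mulr1 => /eqP; rewrite subr_eq0 => /eqP /(congr1 (fun x => x < 0)).
    by rewrite !signr_lt0 mi.
  by rewrite mulr0 subr0 => /eqP; rewrite (negbTE u0).
have mj : j = m by lia.
have -> : (i == m') = false by lia.
have -> : (j == m') = false by lia.
rewrite mj eqxx mulr0 !add0r mulr1 => /eqP.
by rewrite oppr_eq0 mulf_eq0 (negbTE s0) (negbTE u0).
Qed.

(** If m belongs to neither block, then e_m lies in the flat and is not
orthogonal to the root. *)
Lemma flat_roots i j s k l t m m' u :
  disjoint_pairs i j k l -> (m < m' < n)%N ->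
  (flat i j s k l t <= hyperplane (pair_root m m' u))%VS ->
  [/\ m = i, m' = j & u = s] \/ [/\ m = k, m' = l & u = t].
Proof.
move=> dp mm' h.
have [mij|mij] := boolP ((m == i) || (m == j)).
  by left; apply: flat_root_in_block dp mm' mij h.
have [mkl|mkl] := boolP ((m == k) || (m == l)).
  right; rewrite flatC in h; rewrite disjoint_pairsC in dp.
  exact: flat_root_in_block dp mm' mkl h.
case/and5P: dp => ijn kln ik il /andP[jk jl].
move: mij mkl; rewrite !negb_or => /andP[mi mj] /andP[mk ml].
have := flat_sub_hyperplane h (x := evec m).
rewrite !dot_evec_pair; try lia.
rewrite (negbTE mi) (negbTE mj) (negbTE mk) (negbTE ml) !mulr0 !addr0.
move=> /(_ erefl erefl); have -> : (m == m') = false by lia.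
by rewrite eqxx mulr1 add0r => /eqP; rewrite signr_eq0.
Qed.

(** The roots vanishing on a flat are recovered from it, as an unordered pair;
the conditions i < k and i' < k' order the pair. *)
Lemma flat_inj i j s k l t i' j' s' k' l' t' :
  disjoint_pairs i j k l -> disjoint_pairs i' j' k' l' -> (i < k)%N -> (i' < k')%N ->
  flat i j s k l t = flat i' j' s' k' l' t' ->
  [/\ i = i', j = j' & s = s'] /\ [/\ k = k', l = l' & t = t'].
Proof.
move=> dp dp' ik ik' E.
have ha : (flat i' j' s' k' l' t' <= hyperplane (pair_root i j s))%VS.
  by rewrite -E; apply: capvSl.
have hb : (flat i' j' s' k' l' t' <= hyperplane (pair_root k l t))%VS.
  by rewrite -E; apply: capvSr.
have [ijn kln] : (i < j < n)%N /\ (k < l < n)%N by move: dp => /and5P[].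
case: (flat_roots dp' ijn ha) => -[? ? ?]; case: (flat_roots dp' kln hb) => -[? ? ?];
  subst; by [lia | split].
Qed.

(** The three perfect matchings of a four-element set, listed so that the first
pair contains the minimum and each pair is increasing. *)
Definition matching (w : seq nat) (r : nat) : nat * nat * nat * nat := (
  let a := nth 0 w 0 in let b := nth 0 w 1 in
  let c := nth 0 w 2 in let d := nth 0 w 3 in
  if r == 0%N then (a, b, c, d) else
  if r == 1%N then (a, c, b, d) else (a, d, b, c))%N.

Definition flat_of (q : 4.-tuple 'I_n * 'I_3 * (bool * bool)) :=
  let: (i, j, k, l) := matching (map val q.1.1) q.1.2 in
  flat i j q.2.1 k l q.2.2.

Definition flat_index := setX (setX [set w : 4.-tuple 'I_n | sorted ltn (map val w)]
   [set: 'I_3]) [set: bool * bool].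

Lemma card_flat_index : #|flat_index| = (12 * 'C(n, 4))%N.
Proof.
by rewrite !cardsX card_ltn_sorted_tuples !cardsT card_ord card_prod card_bool; lia.
Qed.

Lemma flat_ofP w r s t : (w, r, (s, t)) \in flat_index ->
  exists i j k l, [/\ disjoint_pairs i j k l, (i < k)%N,
    matching (map val w) r = (i, j, k, l) & flat_of (w, r, (s, t)) = flat i j s k l t].
Proof.
rewrite !inE !andbT; case/tupleP: w => a w; case/tupleP: w => b w.
case/tupleP: w => c w; case/tupleP: w => d w; rewrite (tuple0 w) /= andbT.
move=> /and3P[ab bc cd]; rewrite /flat_of /matching /=.
have [aN bN cN dN] : [/\ a < n, b < n, c < n & d < n]%N by split; apply: ltn_ord.
case: ifP => r0; last case: ifP => r1.
- by exists a, b, c, d; split=> //; [rewrite /disjoint_pairs; lia|lia].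
- by exists a, c, b, d; split=> //; rewrite /disjoint_pairs; lia.
- by exists a, d, b, c; split=> //; rewrite /disjoint_pairs; lia.
Qed.

Lemma matching_inj (w w' : 4.-tuple 'I_n) (r r' : 'I_3) :
  sorted ltn (map val w) -> sorted ltn (map val w') ->
  matching (map val w) r = matching (map val w') r' -> w = w' /\ r = r'.
Proof.
case/tupleP: w => a w; case/tupleP: w => b w.
case/tupleP: w => c w; case/tupleP: w => d w; rewrite (tuple0 w) /= andbT.
case/tupleP: w' => a' w'; case/tupleP: w' => b' w'.
case/tupleP: w' => c' w'; case/tupleP: w' => d' w'; rewrite (tuple0 w') /= andbT.
move=> /and3P[ab bc cd] /and3P[ab' bc' cd'] E.
suff [Ea Eb Ec Ed Er] : [/\ a = a', b = b', c = c', d = d' & r = r'].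
  by split=> //; apply: val_inj; rewrite /= Ea Eb Ec Ed.
move: E (ltn_ord r) (ltn_ord r'); rewrite /matching /=.
by (repeat case: ifP => ?); case=> *; split; apply: val_inj => /=; lia.
Qed.

Lemma leq_card_L2 : (12 * 'C(n, 4) <= #|` L2 R n|)%N.
Proof.
rewrite -card_flat_index cardE -(size_map flat_of); apply: uniq_leq_size.
  rewrite map_inj_in_uniq ?enum_uniq // => -[[w r] [s t]] [[w' r'] [s' t']].
  rewrite !mem_enum => q q'; move: (q) (q'); rewrite !inE /= !andbT => sw sw'.
  have [i [j [k [l [dp ik mE ->]]]]] := flat_ofP q.
  have [i' [j' [k' [l' [dp' ik' mE' ->]]]]] := flat_ofP q'.
  case/(flat_inj dp dp' ik ik') => -[Ei Ej ->] [Ek El ->].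
  by have [|-> ->] := matching_inj sw sw' (r := r) (r' := r'); rewrite ?mE ?mE' ?Ei ?Ej ?Ek ?El.
move=> U /mapP[[[w r] [s t]]]; rewrite mem_enum => q ->.
have [i [j [k [l [dp _ _ ->]]]]] := flat_ofP q.
exact: flat_in_L2.
Qed.

End Flats.

(** * The diameter *)

Lemma ex_least (P : nat -> Prop) :
  (exists k, P k) -> exists2 k, P k & forall j, P j -> (k <= j)%N.
Proof.
case=> k; elim/ltn_ind: k => k IH Pk.
have [[j Pj jk]|h] := classic (exists2 j, P j & (j < k)%N); first exact: IH jk Pj.
by exists k => // j Pj; rewrite leqNgt; apply/negP => jk; apply: h; exists j.
Qed.

Lemma ex_greatest (P : nat -> Prop) b : (exists k, P k) ->
  (forall k, P k -> (k <= b)%N) -> exists2 k, P k & forall j, P j -> (j <= k)%N.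
Proof.
move=> [k Pk] hb.
have [|m [m' Pm' em] hm] := @ex_least (fun m => exists2 j, P j & m = b - j)%N.
  by exists (b - k)%N, k.
exists m' => // j Pj; have := hm _ (ex_intro2 _ _ _ Pj erefl).
by have := hb _ Pj; have := hb _ Pm'; lia.
Qed.

(** The distances between vertices are bounded, so one of them is largest. *)
Lemma ex_graph_diam (T : Type) (vertex : T -> Prop) (edge : T -> T -> Prop) b :
  (exists x, vertex x) ->
  (forall x y, vertex x -> vertex y -> exists2 k, (k <= b)%N & walk edge k x y) ->
  exists2 d, graph_diam vertex edge d & (d <= b)%N.
Proof.
move=> [x0 vx0] hb.
have dist x y : vertex x -> vertex y -> exists2 k, graph_dist edge x y k & (k <= b)%N.
  move=> vx vy; have [k kb w] := hb x y vx vy.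
  have [|j wj hj] := @ex_least (fun j => walk edge j x y); first by exists k.
  by exists j; [split|apply: leq_trans kb; apply: hj].
have dist_uniq x y j k : graph_dist edge x y j -> graph_dist edge x y k -> j = k.
  by move=> [wj hj] [wk hk]; apply/eqP; rewrite eqn_leq hj ?hk.
pose P d := exists x y, [/\ vertex x, vertex y & graph_dist edge x y d].
have Pb d : P d -> (d <= b)%N.
  move=> [x [y [vx vy xyd]]]; have [k xyk kb] := dist x y vx vy.
  by rewrite (dist_uniq _ _ _ _ xyd xyk).
have [|d Pd hd] := @ex_greatest P b _ Pb.
  by have [k h _] := dist x0 x0 vx0 vx0; exists k, x0, x0.
exists d; last exact: Pb.
split=> // x y vx vy; have [k h _] := dist x y vx vy.
by exists k => //; apply: hd; exists x, y.
Qed.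

Section ReducedWords.
Variables (R : realType) (n : nat).
Hypothesis n1 : (1 < n)%N.
Local Notation nat_prod := (@nat_prod R n).

Lemma word_prodE (s : seq 'I_n) : word_prod R s = nat_prod (map val s).
Proof. by symmetry; apply: big_map. Qed.

Lemma below_val (s : seq 'I_n) : below n (map val s).
Proof. by rewrite /below all_map; apply/allP => i _ /=. Qed.

(** Out-of-range numbers are sent to the letter 0, so the properties below are
restricted to words with letters below n. *)
Definition letter : nat -> 'I_n := insubd (Ordinal (ltnW n1)).
Definition word_of := map letter.

Lemma val_word_of s : below n s -> map val (word_of s) = s.
Proof.
elim: s => //= i s IH /andP[iN bs]; rewrite IH //; congr (_ :: _).
by rewrite val_insubd iN.
Qed.

Lemma word_ofK (s : seq 'I_n) : word_of (map val s) = s.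
Proof.
rewrite /word_of -map_comp map_id_in // => i _.
by apply: val_inj; rewrite val_insubd ltn_ord.
Qed.

Lemma word_prod_of s : below n s -> word_prod R (word_of s) = nat_prod s.
Proof. by move=> bs; rewrite word_prodE val_word_of. Qed.

Lemma braid_move_of x y : move x y -> below n x -> braid_move R (word_of x) (word_of y).
Proof.
have root_letter t : (t < n)%N -> simple_root R (letter t) = nat_root R n t.
  by move=> tN; rewrite /simple_root /letter val_insubd tN.
have letter_neq i j : (i < n)%N -> (j < n)%N -> i != j -> letter i != letter j.
  by move=> iN jN; rewrite -val_eqE !val_insubd iN jN.
case=> a b i j h; rewrite /below all_cat => /and4P[_ iN jN _];
  have [ui uj] := (sqnorm2_nat_root R n1 iN, sqnorm2_nat_root R n1 jN);
  exists (word_of a), (word_of b), (letter i), (letter j).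
  case/andP: h => ij hl.
  exists 2; split; rewrite ?/word_of ?map_cat //; first exact: letter_neq.
  rewrite /simple_refl !root_letter //; apply: refl_order2 => //.
  by rewrite dot_nat_root // (negbTE ij) (negbTE hl).
have ij : i != j by move: h; rewrite /linked; lia.
exists 3; split; rewrite ?/word_of ?map_cat //; first exact: letter_neq.
rewrite /simple_refl !root_letter //; apply: refl_order3 => //.
by rewrite dot_nat_root // (negbTE ij) h.
Qed.

Lemma reduced_move (w : 'M[R]_n) x y : move x y -> below n x ->
  reduced_word w (word_of x) -> reduced_word w (word_of y).
Proof.
move=> xy bx [xw hx]; have bY : below n y by rewrite /below -(move_all _ xy).
split; first by rewrite word_prod_of // -(nat_prod_move R n1 xy) // -word_prod_of.
by move=> t /hx; rewrite !size_map (move_size xy).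
Qed.

Lemma G_walk_of (w : 'M[R]_n) k x y : walk move k x y -> below n x ->
  reduced_word w (word_of x) -> walk (G_edge w) k (word_of x) (word_of y).
Proof.
elim=> [z _ _|{}k {}x {}y z xy _ IH bx rx]; first exact: walk_nil.
have ry := reduced_move xy bx rx.
apply: walk_cons (IH _ ry); first by split=> //; apply: braid_move_of.
by rewrite /below -(move_all _ xy).
Qed.

Lemma G_walk_within (w : 'M[R]_n) d (s t : seq 'I_n) :
  within d (map val s) (map val t) -> reduced_word w s ->
  exists2 k, (k <= d)%N & walk (G_edge w) k s t.
Proof.
move=> [k kd h] rs; exists k => //.
rewrite -(word_ofK s) -(word_ofK t); apply: G_walk_of h _ _; first exact: below_val.
by rewrite word_ofK.
Qed.

(** A factor i i could be deleted without changing the product. *)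
Lemma reduced_tight (w : 'M[R]_n) (s : seq 'I_n) :
  reduced_word w s -> tight (map val s).
Proof.
move=> [sw hs] d x i y h.
have bs := below_val s; have := bs.
rewrite /below (within_all _ h) all_cat /= => /and4P[bx iN _ bY].
have bxy : below n (x ++ y) by rewrite /below all_cat bx bY.
have := hs (word_of (x ++ y)); rewrite word_prod_of // -(nat_prod_cancel R n1 _ _ iN).
rewrite -(nat_prod_within R n1 h) // -word_prodE => /(_ sw).
by have := within_size h; rewrite !size_map !size_cat /=; lia.
Qed.

Lemma all_gen_val (s : seq 'I_n) : all (gen n) (map val s).
Proof. by rewrite all_map; apply/allP => i _ /=; rewrite /gen n1 /=. Qed.

Lemma weyl_word_prod (s : seq 'I_n) : weyl (word_prod R s).
Proof.
elim: s => [|i s IH]; first by rewrite /word_prod big_nil; apply: weyl_one.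
by rewrite /word_prod big_cons -mulmxE; apply: weyl_mul IH; apply: weyl_gen.
Qed.

Lemma reduced_longest :
  reduced_word (nat_prod (longest_chain_last n)) (word_of (longest_chain_last n)).
Proof.
have bl : below n (longest_chain_last n) by apply: gen_below (all_gen_longest n).
split; first exact: word_prod_of.
move=> t; rewrite word_prodE size_map size_longest => Et.
by rewrite -(size_map val); apply: (longest_minimal n1) Et; [lia|apply: all_gen_val].
Qed.

(** At most n(n-1) letters by [tight_routes]; at least as many because the
word of [longest_minimal] is reduced and w0 has maximal length. *)
Lemma size_reduced_longest w0 (s : seq 'I_n) : longest_element w0 ->
  @reduced_word R n w0 s -> size s = (n * n.-1)%N.
Proof.
move=> [_ [l [s' rs' sl] hl]] rs.
have ss' : size s = size s'.
  by apply/eqP; rewrite eqn_leq (proj2 rs) ?(proj2 rs') //; [case: rs|case: rs'].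
have [h1 _] := tight_routes (ltnW n1) (all_gen_val s) (reduced_tight rs).
rewrite size_map in h1; apply/eqP; rewrite eqn_leq h1 ss' sl /=.
apply: (hl (nat_prod (longest_chain_last n))).
  rewrite -word_prod_of; first exact: weyl_word_prod.
  by apply: gen_below (all_gen_longest n).
by exists (word_of (longest_chain_last n)); [exact: reduced_longest|rewrite size_map size_longest].
Qed.

(** The route through one extreme word and the route through the other have
total length at most twice the bound. *)
Lemma G_walk_route_bound w0 (s t : seq 'I_n) : @longest_element R n w0 ->
  reduced_word w0 s -> reduced_word w0 t ->
  exists2 k, (k <= route_bound n)%N & walk (G_edge w0) k s t.
Proof.
move=> hw0 rs rt.
have route u : reduced_word w0 u -> exists a b,
    [/\ within a (map val u) (longest_chain_last n), within b (map val u) (longest_chain_first n)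
      & (a + b <= route_bound n)%N].
  move=> ru; have [_] := tight_routes (ltnW n1) (all_gen_val u) (reduced_tight ru).
  by apply; rewrite size_map (size_reduced_longest hw0 ru).
have [a [b [sa sb ab]]] := route s rs.
have [a' [b' [ta tb ab']]] := route t rt.
have [le|le] := leqP (a + a') (b + b').
  have [k kd h] := G_walk_within (within_trans sa (within_sym ta)) rs.
  by exists k => //; lia.
have [k kd h] := G_walk_within (within_trans sb (within_sym tb)) rs.
by exists k => //; lia.
Qed.

End ReducedWords.

(** With 2 * 12 * 'C(n, 4) = n(n-1)(n-2)(n-3) this is an inequality between
polynomials in n. *)
Lemma route_bound_lt n b : (1 < n)%N -> (12 * 'C(n, 4) <= b)%N ->
  (3 * route_bound n < 3 * b + 4 * n ^ 3)%N.
Proof.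
move=> n1 hb; have hd := route_boundE (ltnW n1).
have hc : ('C(n, 4) * 24 = n * (n.-1 * (n - 2) * (n - 3)))%N.
  by have := bin_ffact n 4; rewrite (_ : 4`! = 24)%N // => ->; rewrite !ffactnS ffactn0; lia.
case: n n1 hb hd hc => [|[|[|n]]] // _ hb hd hc.
  by move: hd; rewrite /=; lia.
move: hd hc; rewrite !subSS !subn0 /= => hd hc; nia.
Qed.

Theorem corollary5p5 (R : realType) (n : nat) (hn : (2 <= n)%N)
    (w0 : 'M[R]_n) (hw0 : longest_element w0) :
  exists2 d : nat, graph_diam (reduced_word w0) (G_edge w0) d &
    d%:R < #|` L2 R n|%:R + 4 / 3 * n%:R ^+ 3 :> R.
Proof.
have [s rs] : exists s, reduced_word w0 s.
  by case: hw0 => _ [l [s rs _] _]; exists s.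
have [d hd db] := ex_graph_diam (ex_intro _ s rs)
  (fun x y rx ry => G_walk_route_bound hn hw0 rx ry).
exists d => //; have := route_bound_lt hn (leq_card_L2 R n).
rewrite -(ltr_nat R) natrD !(natrM _ 3) (natrM _ 4) natrX => h.
have : (d%:R <= (route_bound n)%:R :> R) by rewrite ler_nat.
lra.
Qed.
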